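(* For all integers $n\geq 0$, \[ \sigma_e\mathrm{mex}(10n+6)\equiv 0 \pmod{4}\qquad\text{and}\qquad \sigma_e\mathrm{mex}(10n+8)\equiv 0 \pmod{4}. \]
   Context: A partition of a nonnegative integer $n$ is a non-increasing sequence of positive integers (parts) summing to $n$; $\mathcal{P}(n)$ denotes the set of partitions of $n$. The minimal excludant $\mathrm{mex}(\pi)$ of a partition $\pi$ is the least positive integer that is not a part of $\pi$. Define $\sigma_e\mathrm{mex}(n):=\sum_{\pi\in\mathcal{P}(n),\ 2\mid \mathrm{mex}(\pi)}\mathrm{mex}(\pi)$, the sum of the even minimal excludants over all partitions of $n$. *)

(* Defs.v *)
From mathcomp Require Import all_boot.

Set Implicit Arguments.
Unset Strict Implicit.
Unset Printing Implicit Defensive.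

Definition is_partition (n : nat) (s : seq nat) : bool :=
  [&& sorted geq s, all (leq 1) s & sumn s == n].

(* The parts of a partition of n are at most n, and so is their number, so the
   partitions of n are found among the sequences of length at most n over 'I_n.+1;
   mem_partitions and partitions_uniq below show that nothing is lost or
   repeated. *)
Definition partitions (n : nat) : seq (seq nat) :=
  [seq s <- [seq map val (b : seq 'I_n.+1) | b : n.-bseq 'I_n.+1]
     | is_partition n s].

Lemma mem_partitions (n : nat) (s : seq nat) :
  (s \in partitions n) = is_partition n s.
Proof.
rewrite mem_filter; case: (boolP (is_partition n s)) => //= /and3P[_ pos /eqP sn].
have szs : size s <= n.
  rewrite -sn; elim: s pos {sn} => //= x s IHs /andP[x0 /IHs szs].
  by rewrite -add1n leq_add.
have les : all (fun x => x < n.+1) s.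
  apply/allP=> x xs; rewrite ltnS -sn sumnE (big_rem x xs) /=; exact: leq_addr.
have szi : size (map (@inord n) s) <= n by rewrite size_map.
apply/mapP; exists (Bseq szi); first by rewrite mem_enum.
rewrite /= -map_comp -[LHS]map_id; apply/eq_in_map => x xs /=.
by rewrite inordK //; move/allP: les; exact.
Qed.

Lemma partitions_uniq (n : nat) : uniq (partitions n).
Proof.
apply: filter_uniq; rewrite map_inj_uniq ?enum_uniq // => b c /= eq_bc.
by apply/val_inj/(inj_map val_inj).
Qed.

Lemma mex_exists (s : seq nat) : exists m, (0 < m) && (m \notin s).
Proof.
exists (sumn s).+1; apply/negP => ss.
have : (sumn s).+1 <= sumn s by rewrite {2}sumnE (big_rem _ ss) leq_addr.
by rewrite ltnn.
Qed.

Definition mex (s : seq nat) : nat := ex_minn (mex_exists s).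

Definition sigma_e_mex (n : nat) : nat :=
  \sum_(p <- partitions n | 2 %| mex p) mex p.

(* Main.v *)
Require Import Defs.
From mathcomp Require Import all_boot all_algebra zify ring.

(** Write E = prod_(i >= 1) (1 - q^i), P = 1 / E and psi = sum_m q^(m(m+1)/2).
    Since P(q) q^(m(m+1)/2) counts the partitions with mex > m, half of the sum
    of even mex's has the parity of the coefficients of P psi_o, where psi_o
    collects the odd powers of psi.  The Jacobi triple product gives, modulo 2,
    psi = E^3 and E = sum_k q^(k(3k-1)/2).  Hence P = psi P^4 with P^4 even, so
    the even part of P psi_o is (psi_o P^2)^2, and psi_o P^2 is the odd part of
    psi P^2 = E.  Thus the coefficient at q^(2m) vanishes unless m is a
    pentagonal number, and no pentagonal number is 3 or 4 modulo 5. *)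

Set Implicit Arguments.
Unset Strict Implicit.
Unset Printing Implicit Defensive.
Import GRing.Theory.

(** * Removing a part; partitions with bounded parts *)

Lemma count_split (T : Type) (a b : pred T) (s : seq T) :
  count a s = count (predI (predC b) a) s + count (predI b a) s.
Proof. by rewrite -2!count_filter addnC count_predC size_filter. Qed.

Lemma geq_trans : transitive geq.
Proof. by move=> y x z /= yx zy; apply: leq_trans zy yx. Qed.

Lemma geq_anti : antisymmetric geq.
Proof. by move=> x y /= /andP[yx xy]; apply/eqP; rewrite eqn_leq xy yx. Qed.

Lemma geq_total : total geq.
Proof. by move=> x y; apply: leq_total. Qed.

(** Removal of one [j] is undone by inserting [j] and sorting again; it is injective because a
    sorted sequence is determined by its multiset. *)
Lemma perm_partitions_rem (n j : nat) : 0 < j ->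
  perm_eq [seq rem j s | s <- partitions (n + j) & j \in s] (partitions n).
Proof.
move=> j_gt0; apply: uniq_perm; last 1 first.
- move=> s; rewrite mem_partitions; apply/mapP/idP => [[t]|s_part].
    rewrite mem_filter mem_partitions => /andP[jt /and3P[t_sorted t_pos /eqP st] ->].
    apply/and3P; split.
    + exact: (subseq_sorted geq_trans (rem_subseq j t)).
    + by apply/allP => x /mem_rem; apply: (allP t_pos).
    + have := perm_sumn (perm_to_rem jt); rewrite /= st; lia.
  have /and3P[s_sorted s_pos /eqP sn] := s_part.
  have jt : j \in sort geq (j :: s) by rewrite mem_sort mem_head.
  have pt : perm_eq (sort geq (j :: s)) (j :: s) by rewrite perm_sort.
  exists (sort geq (j :: s)).
    rewrite mem_filter jt /= mem_partitions; apply/and3P; split.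
    + by apply: sort_sorted; exact: geq_total.
    + by rewrite (perm_all _ pt) /= j_gt0.
    + by rewrite (perm_sumn pt) /= sn addnC.
  apply: (sorted_eq geq_trans geq_anti) => //.
    apply: (subseq_sorted geq_trans (rem_subseq j _)).
    by apply: sort_sorted; exact: geq_total.
  rewrite -(perm_cons j); rewrite perm_sym.
  by apply: perm_trans pt; rewrite perm_sym perm_to_rem.
- rewrite map_inj_in_uniq; first exact/filter_uniq/partitions_uniq.
  move=> s t.
  rewrite mem_filter mem_partitions => /andP[js /and3P[s_sorted _ _]].
  rewrite mem_filter mem_partitions => /andP[jt /and3P[t_sorted _ _]] eq_st.
  apply: (sorted_eq geq_trans geq_anti) => //.
  apply: perm_trans (perm_to_rem js) _.
  by rewrite eq_st perm_sym perm_to_rem.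
- exact: partitions_uniq.
Qed.

Lemma count_partitions_rem (A : pred (seq nat)) (n j : nat) : 0 < j ->
  count (fun s => (j \in s) && A (rem j s)) (partitions (n + j)) =
  count A (partitions n).
Proof.
move=> j_gt0; rewrite -(permP (perm_partitions_rem n j_gt0)) count_map.
by rewrite [RHS]count_filter; apply: eq_count => s /=; rewrite andbC.
Qed.

Lemma part_le (n j : nat) (s : seq nat) : s \in partitions n -> j \in s -> j <= n.
Proof.
rewrite mem_partitions => /and3P[_ _ /eqP <-] js.
by rewrite (perm_sumn (perm_to_rem js)) /= leq_addr.
Qed.

(** Bounding the parts by [k] gives a recurrence in [k] that matches the factors of the Euler
    product one at a time. *)
Definition nb_partitions (k n : nat) : nat := count (all (geq k)) (partitions n).

Lemma nb_partitions0 n : nb_partitions 0 n = (n == 0).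
Proof.
rewrite /nb_partitions; case: n => [|n] /=.
  have /perm_size : perm_eq (filter (all (geq 0)) (partitions 0)) [:: [::]].
    apply: uniq_perm => [||s] //; first exact/filter_uniq/partitions_uniq.
    rewrite mem_filter mem_partitions inE; case: s => [|x s] //=.
    by rewrite /is_partition /=; case: x => [|x] /=; rewrite ?andbF.
  by rewrite size_filter.
apply/eqP; rewrite -leqn0 leqNgt -has_count; apply/hasPn => s.
rewrite mem_partitions => /and3P[_ s_pos /eqP sn].
case: s s_pos sn => [|x s] //= /andP[x_gt0 _] _.
by rewrite leqNgt x_gt0.
Qed.

Lemma all_geqS (k : nat) (s : seq nat) :
  all (geq k) s = (k.+1 \notin s) && all (geq k.+1) s.
Proof.
elim: s => //= x s ->; rewrite inE; case: (k.+1 \in s); rewrite /= ?andbF ?orbF //=; lia.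
Qed.

Lemma nb_partitionsS (k n : nat) :
  nb_partitions k.+1 n =
  nb_partitions k n + (if k < n then nb_partitions k.+1 (n - k.+1) else 0).
Proof.
rewrite /nb_partitions (count_split _ (fun s => k.+1 \in s)); congr (_ + _).
  by apply: eq_count => s /=; rewrite [RHS]all_geqS.
case: ltnP => [lt_kn|le_nk].
  rewrite -[in LHS](subnK lt_kn) -[RHS](count_partitions_rem _ _ (ltn0Sn k)).
  apply: eq_count => s /=; case ks: (k.+1 \in s) => //=.
  by rewrite (perm_all _ (perm_to_rem ks)) /= leqnn.
apply/eqP; rewrite -leqn0 leqNgt -has_count; apply/hasPn => s s_part /=.
by apply: contraTN le_nk => /andP[/(part_le s_part)]; rewrite -ltnNge.
Qed.

Lemma nb_partitions_all (k n : nat) : n <= k ->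
  nb_partitions k n = size (partitions n).
Proof.
move=> le_nk; rewrite /nb_partitions -count_predT; apply: eq_in_count => s s_part.
by apply/allP => x /(part_le s_part) le_xn /=; apply: leq_trans le_nk.
Qed.

(** * Minimal excludants and triangular numbers *)

Lemma mex_gtE (s : seq nat) (m : nat) :
  (m < mex s) = all (fun i => i \in s) (iota 1 m).
Proof.
rewrite /mex; case: ex_minnP => x /andP[x_gt0 xs] x_min.
apply/idP/allP => [lt_mx i|m_in].
  rewrite mem_iota => /andP[i_gt0 lt_im]; apply: contraT => is'.
  have := x_min i; rewrite i_gt0 is' => /(_ isT); lia.
rewrite ltnNge; apply: contra xs => le_xm; apply: m_in.
by rewrite mem_iota x_gt0.
Qed.

(** A mex above [m] means that 1, ..., m all occur; deleting one copy of each, from the largest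
    down, lowers the sum by 1 + ... + m = ['C(m.+1, 2)]. *)
Lemma count_mex_gt (m n : nat) :
  count (fun s => m < mex s) (partitions n) =
  if 'C(m.+1, 2) <= n then size (partitions (n - 'C(m.+1, 2))) else 0.
Proof.
elim: m n => [|m IHm] n.
  rewrite /= subn0 -count_predT; apply: eq_count => s.
  by rewrite mex_gtE.
rewrite binS bin1 addnC; case: (ltnP m n) => [lt_mn|le_nm]; last first.
  rewrite leqNgt (leq_ltn_trans le_nm) ?ltn_addr //.
  apply/eqP; rewrite -leqn0 leqNgt -has_count; apply/hasPn => s s_part /=.
  rewrite mex_gtE; apply: contraTN le_nm => /allP/(_ m.+1).
  by rewrite mem_iota -ltnNge => /(_ _)/(part_le s_part); apply; lia.
rewrite -{1}(subnK lt_mn).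
rewrite -(leq_subRL _ lt_mn) subnDA -IHm.
rewrite -[RHS](count_partitions_rem _ _ (ltn0Sn m)); apply: eq_count => s.
have iotaS : iota 1 m.+1 = iota 1 m ++ [:: m.+1] by rewrite -(iotaD 1 m 1) addn1.
rewrite !mex_gtE iotaS all_cat /= andbT andbC.
case ms: (m.+1 \in s) => //=; apply: eq_in_all => i.
rewrite mem_iota => /andP[_ lt_im]; rewrite (perm_mem (perm_to_rem ms)) inE.
by rewrite ltn_eqF.
Qed.

Local Open Scope ring_scope.

(** * Gaussian binomials and the q-binomial theorem *)

Section QBinomial.
Variables (R : comNzRingType) (q : R).

(** The Gaussian binomial, given by its Pascal rule because [R] has no division. *)
Fixpoint qbin (n k : nat) : R :=
  match n, k with
  | _, 0 => 1
  | 0, _.+1 => 0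
  | n'.+1, k'.+1 => qbin n' k' + q ^+ k'.+1 * qbin n' k'.+1
  end.

#[local] Arguments qbin : simpl never.

Definition qpoch (n : nat) : R := \prod_(i < n) (1 - q ^+ i.+1).

Lemma qbin0 n : qbin n 0 = 1. Proof. by case: n. Qed.

Lemma qbinS n k : qbin n.+1 k.+1 = qbin n k + q ^+ k.+1 * qbin n k.+1.
Proof. by []. Qed.

Lemma qbin_small n k : (n < k)%N -> qbin n k = 0.
Proof.
elim: n k => [|n IHn] [|k] // lt_nk.
by rewrite qbinS !IHn ?mulr0 ?addr0 //; lia.
Qed.

Lemma qpochS n : qpoch n.+1 = qpoch n * (1 - q ^+ n.+1).
Proof. by rewrite /qpoch big_ord_recr. Qed.

Lemma qbin_qpoch m k : qbin (k + m) k * qpoch k * qpoch m = qpoch (k + m).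
Proof.
elim: k m => [|k IHk] m; first by rewrite qbin0 /qpoch big_ord0 !mul1r add0n.
elim: m => [|m IHm].
  have := IHk 0; rewrite !addn0 qbinS (@qbin_small k k.+1) // mulr0 addr0.
  by rewrite !qpochS => h0; rewrite -[in RHS]h0; ring.
rewrite addSn qbinS.
have h1 := IHk m.+1; rewrite addSnnS in IHm.
rewrite addnS in h1 IHm *; rewrite [qpoch (k + m).+2]qpochS.
(* This splitting matches the two terms of the Pascal rule. *)
have -> : 1 - q ^+ (k + m).+2 =
    (1 - q ^+ k.+1) + q ^+ k.+1 * (1 - q ^+ m.+1).
  by rewrite mulrBr -exprD mulr1 addSn addnS addrA subrK.
rewrite [RHS]mulrDr -{1}h1 -IHm !qpochS; ring.
Qed.

(** Induction peels off the factor [i = 0] and replaces [x] by [x * q]. The homogeneous form with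
    [y] serves to avoid negative powers of [q] in the triple product. *)
Lemma qbinomial_theorem n (x y : R) :
  \prod_(i < n) (y + x * q ^+ i) =
  \sum_(k < n.+1) qbin n k * q ^+ 'C(k, 2) * x ^+ k * y ^+ (n - k).
Proof.
elim: n x => [|n IHn] x.
  by rewrite big_ord0 big_ord1 /= expr0 !mulr1.
rewrite big_ord_recl /= mulr1 /bump /=.
under eq_bigr => i _ do rewrite add1n exprS mulrA.
rewrite IHn mulrDl.
have -> : y * (\sum_(k < n.+1) qbin n k * q ^+ 'C(k, 2) * (x * q) ^+ k * y ^+ (n - k))
   = \sum_(k < n.+2) qbin n k * q ^+ 'C(k, 2) * (x * q) ^+ k * y ^+ (n.+1 - k).
  rewrite [RHS]big_ord_recr /= (@qbin_small n n.+1) // !mul0r addr0 mulr_sumr.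
  apply: eq_bigr => k _; rewrite subSn; last by rewrite -ltnS.
  by rewrite exprS mulrCA.
rewrite big_ord_recl [RHS]big_ord_recl /= qbin0 !expr0 -addrA; congr (_ + _).
rewrite mulr_sumr -big_split /=; apply: eq_bigr => k _.
rewrite /bump /= add1n subSS binS bin1 qbinS !exprMn.
move: (qbin n k) (qbin n k.+1) (n - k)%N 'C(k, 2) => u v a b.
by rewrite !exprD !exprS; ring.
Qed.

End QBinomial.

(** * Polynomials modulo a power of X, in place of power series *)

Section TruncatedPoly.
Variable F : fieldType.
Implicit Types (p u : {poly F}) (M : nat).

Definition eqmodX M p u := 'X^M %| p - u.

Lemma eqmodX_refl M p : eqmodX M p p.
Proof. by rewrite /eqmodX subrr dvdp0. Qed.

Lemma eqmodX_sym M p u : eqmodX M p u -> eqmodX M u p.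
Proof. by rewrite /eqmodX -dvdpNr opprB. Qed.

Lemma eqmodX_trans M p u v : eqmodX M p u -> eqmodX M u v -> eqmodX M p v.
Proof. by move=> pu uv; rewrite /eqmodX -(subrK u p) -addrA dvdp_add. Qed.

Lemma eqmodXM M p1 u1 p2 u2 :
  eqmodX M p1 u1 -> eqmodX M p2 u2 -> eqmodX M (p1 * p2) (u1 * u2).
Proof.
move=> h1 h2; rewrite /eqmodX.
have -> : p1 * p2 - u1 * u2 = (p1 - u1) * p2 + u1 * (p2 - u2) by ring.
by apply: dvdp_add; [apply: dvdp_mulr | apply: dvdp_mull].
Qed.

Lemma eqmodXMl M p u v : eqmodX M u v -> eqmodX M (p * u) (p * v).
Proof. by move=> uv; apply: eqmodXM => //; apply: eqmodX_refl. Qed.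

Lemma eqmodXX M k p u : eqmodX M p u -> eqmodX M (p ^+ k) (u ^+ k).
Proof.
move=> h; elim: k => [|k IHk]; first exact: eqmodX_refl.
by rewrite !exprS eqmodXM.
Qed.

Lemma eqmodX_leq M N p u : (N <= M)%N -> eqmodX M p u -> eqmodX N p u.
Proof. by move=> le_NM; apply: dvdp_trans; apply: dvdp_exp2l. Qed.

Lemma eqmodX_sum M n (f g : 'I_n -> {poly F}) :
  (forall i, eqmodX M (f i) (g i)) -> eqmodX M (\sum_i f i) (\sum_i g i).
Proof.
by move=> h; rewrite /eqmodX -sumrB; elim/big_ind: _ => [|? ?|i _];
  [exact: dvdp0 | exact: dvdp_add | exact: h].
Qed.

Lemma eqmodXP M p u : reflect (forall i, (i < M)%N -> p`_i = u`_i) (eqmodX M p u).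
Proof.
apply: (iffP idP) => [/dvdpP[v pu] i lt_iM|pu].
  by apply/eqP; rewrite -subr_eq0 -coefB pu coefMXn lt_iM.
rewrite /eqmodX -(poly_take_drop M (p - u)) addrC dvdp_add ?dvdp_mulIr //.
suff -> : take_poly M (p - u) = 0 by rewrite dvdp0.
apply/polyP => i; rewrite coef_take_poly coef0 coefB.
by case: ltnP => // /pu ->; rewrite subrr.
Qed.

(** A polynomial with constant term 1 is coprime to ['X^M], hence cancels. *)
Lemma eqmodXI M p u v : p`_0 = 1 -> eqmodX M (p * u) (p * v) -> eqmodX M u v.
Proof.
move=> p0; rewrite /eqmodX -mulrBr Gauss_dvdpr // coprimep_expl //.
by rewrite coprimep_sym coprimepX rootE horner_coef0 p0 oner_eq0.
Qed.

Lemma eqmodX_mulX M N p u : eqmodX M p u -> eqmodX (M + N) (p * 'X^N) (u * 'X^N).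
Proof. by move=> h; rewrite /eqmodX -mulrBl exprD dvdp_mul2r // expf_neq0 ?polyX_eq0. Qed.

End TruncatedPoly.

(** * The Jacobi triple product, finite and then truncated *)

Lemma bin2D m t : 'C(m + t, 2) = ('C(m, 2) + 'C(t, 2) + m * t)%N.
Proof.
elim: t => [|t IHt]; first by rewrite addn0 muln0 !addn0.
by rewrite addnS !binS !bin1 IHt; lia.
Qed.

Lemma bin2_double t : ('C(t, 2) + 'C(t, 2) + t = t * t)%N.
Proof. by elim: t => // t IHt; rewrite binS bin1; lia. Qed.

Section JacobiTriple.
Variables (F : fieldType) (c a : nat).
Hypotheses (c_gt0 : (0 < c)%N) (le_ac : (a <= c)%N).
Local Notation q := ('X^c : {poly F}).

Lemma qpoch_coef0 n : (qpoch q n)`_0 = 1.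
Proof.
rewrite -horner_coef0 /qpoch horner_prod big1 // => i _.
by rewrite !hornerE -!exprM !expr0n /= muln_eq0 gtn_eqF //= subr0.
Qed.

Lemma qpoch_stable r n : (r <= n)%N -> eqmodX (c * r.+1) (qpoch q n) (qpoch q r).
Proof.
move=> /subnKC <-; elim: (n - r)%N => [|m IHm].
  by rewrite addn0; apply: eqmodX_refl.
rewrite addnS qpochS -[X in eqmodX _ _ X]mulr1; apply: eqmodXM => //.
rewrite /eqmodX addrAC subrr add0r dvdpNr -exprM dvdp_exp2l //.
by rewrite leq_pmul2l // ltnS leq_addr.
Qed.

(** By [qbin_qpoch] the product is a quotient of four [qpoch], each congruent to [qpoch q r]. *)
Lemma qbin_stable r n m k : (r <= n)%N -> (r <= m)%N -> (r <= k)%N ->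
  eqmodX (c * r.+1) (qpoch q n * qbin q (k + m) k) 1.
Proof.
move=> rn rm rk; apply: (eqmodXI (qpoch_coef0 r)).
apply: (@eqmodX_trans _ _ _ (qpoch q (k + m))); last first.
  by rewrite mulr1; apply: qpoch_stable; apply: leq_trans rk (leq_addr _ _).
rewrite -qbin_qpoch mulrA mulrC mulrA.
by do 2?apply: eqmodXM; rewrite ?eqmodX_refl //; do ?[exact: qpoch_stable|
  apply: (@eqmodX_trans _ _ _ (qpoch q r)); [|apply: eqmodX_sym]].
Qed.

(* c t(t-1)/2 + a t for t = k - N, which may be negative *)
Definition jexp N k : nat :=
  if (N <= k)%N then (c * 'C(k - N, 2) + a * (k - N))%N
  else (c * 'C((N - k).+1, 2) - a * (N - k))%N.

Lemma finite_triple_product N :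
  \prod_(j < N) ((1 + 'X^(c * j + a)) * (1 + 'X^(c * j + (c - a)))) =
  \sum_(k < (N + N).+1) qbin q (N + N) k * 'X^(jexp N k).
Proof.
case: N => [|N]; first by rewrite big_ord0 big_ord1 qbin0 mul1r /jexp /= !muln0.
(* [D] is the total power of X that comes out of the [n + n] factors of the q-binomial product at x
   = 1, y = ['X^(c * n - a)]: factor [n - j.+1] gives [c * (n - j.+1)], factor [n + j] gives
   [c * n - a]. *)
set n := N.+1; pose D := (c * 'C(n, 2) + (c * n - a) * n)%N.
have le_acn : (a <= c * n)%N by rewrite /n; nia.
have X_neq0 : 'X^D != 0 :> {poly F} by rewrite expf_neq0 ?polyX_eq0.
apply: (mulfI X_neq0).
transitivity (\prod_(i < n + n) ('X^(c * n - a) + 1 * q ^+ i)).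
  rewrite big_split_ord /= [X in _ = X * _](reindex_inj rev_ord_inj) -big_split /=.
  have XD : 'X^D = \prod_(j < n) ('X^(c * (n - j.+1)) * 'X^(c * n - a)) :> {poly F}.
    rewrite big_split /= prodr_const card_ord -exprM prodrXr /D exprD.
    rewrite -big_distrr /= (reindex_inj rev_ord_inj) /=.
    rewrite (eq_bigr (fun j => nat_of_ord j)) => [|j _]; last first.
      by have := ltn_ord j; lia.
    by rewrite -(big_mkord predT id) bin2_sum.
  rewrite XD -big_split /=; apply: eq_bigr => j _.
  have lt_jn := ltn_ord j.
  have -> : 'X^(c * n - a) + 1 * q ^+ (n - j.+1) =
      'X^(c * (n - j.+1)) * (1 + 'X^(c * j + (c - a))) :> {poly F}.
    rewrite mul1r mulrDr mulr1 -exprM -exprD addrC; congr (_ + 'X^_).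
    by rewrite mulnBr mulnS; nia.
  have -> : 'X^(c * n - a) + 1 * q ^+ (n + j) =
      'X^(c * n - a) * (1 + 'X^(c * j + a)) :> {poly F}.
    rewrite mul1r mulrDr mulr1 -exprM -exprD; congr (_ + 'X^_).
    by rewrite mulnDr; lia.
  by rewrite [RHS]mulrACA [X in _ = _ * X]mulrC.
rewrite qbinomial_theorem mulr_sumr; apply: eq_bigr => k _.
rewrite expr1n mulr1 -!exprM mulrCA -!mulrA -!exprD; congr (_ * 'X^_).
have := ltn_ord k; rewrite ltnS /D /jexp; move: (nat_of_ord k) => {}k le_k.
(* Only exponents remain to be compared; writing [c = a + s] and then [k = n + t] or [n = k + t]
   removes the truncated subtractions. *)
have [s def_c] : exists s, c = (a + s)%N by exists (c - a)%N; rewrite subnKC.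
have -> : (c * n - a = a * N + s * n)%N by rewrite def_c /n; nia.
case: (leqP n k) => [le_nk|lt_kn].
  have [t def_k] : exists t, k = (n + t)%N.
    by exists (k - n)%N; lia.
  have [r def_n] : exists r, n = (t + r)%N by exists (n - t)%N; lia.
  rewrite def_k bin2D addKn subnDl [in (n - t)%N]def_n addKn def_c.
  rewrite /n in def_n *; nia.
have [t def_n] : exists t, n = (k + t)%N.
  by exists (n - k)%N; rewrite subnKC // ltnW.
have -> : (n - k = t)%N by rewrite def_n addKn.
have -> : (n + n - k = n + t)%N by rewrite {1}def_n; lia.
have -> : 'C(n, 2) = ('C(k, 2) + 'C(t, 2) + k * t)%N by rewrite def_n bin2D.
have -> : (c * 'C(t.+1, 2) - a * t = c * 'C(t, 2) + s * t)%N.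
  by rewrite binS bin1 def_c; nia.
have e1 : ((a + s) * ('C(t, 2) + 'C(t, 2) + t) = (a + s) * (t * t))%N.
  by rewrite bin2_double.
have e2 : (a * t * N.+1 = a * t * (k + t))%N by rewrite -def_n.
have e3 : (s * t * N.+1 = s * t * (k + t))%N by rewrite -def_n.
by rewrite def_c /n; lia.
Qed.

(** This makes the error from [qbin_stable], shifted by [jexp N k], invisible modulo X^N. With t the
    distance from k to N, the minimum is N - t, [jexp] is at least c C(t, 2), and t <= C(t, 2) +
    1. *)
Lemma leq_jexp N k : (k <= N + N)%N ->
  (N <= c * (minn k (N + N - k)).+1 + jexp N k)%N.
Proof.
move=> le_k.
have bin2_ge t : (t <= 'C(t, 2).+1)%N.
  by elim: t => // t IHt; rewrite binS bin1; case: t IHt => // t; lia.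
suff: (c * 'C(maxn k (N + N - k) - N, 2) <= jexp N k)%N.
  have := bin2_ge (maxn k (N + N - k) - N)%N; move: ('C(_, _)) => u.
  case: (leqP N k) => ?; [rewrite (maxn_idPl _) ?(minn_idPr _)|
    rewrite (maxn_idPr _) ?(minn_idPl _)]; nia.
rewrite /jexp; case: (leqP N k) => lt_kN; first by rewrite (maxn_idPl _) ?leq_addr //; lia.
rewrite (maxn_idPr _); last lia.
have -> : (N + N - k - N = N - k)%N by lia.
by rewrite binS bin1; nia.
Qed.

(** After multiplication by [qpoch q N] every coefficient of the finite identity may be replaced by
    1. The right side lists k = N, then k = N + t + 1 and k = N - t - 1. *)
Lemma triple_product_mod N :
  eqmodX N
    (qpoch q N *
     \prod_(j < N) ((1 + 'X^(c * j + a)) * (1 + 'X^(c * j + (c - a)))))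
    (1 + \sum_(t < N) ('X^(c * 'C(t.+1, 2) + a * t.+1) +
                       'X^(c * 'C(t.+2, 2) - a * t.+1))).
Proof.
have -> : 1 + \sum_(t < N) ('X^(c * 'C(t.+1, 2) + a * t.+1) +
    'X^(c * 'C(t.+2, 2) - a * t.+1)) =
    \sum_(k < (N + N).+1) 'X^(jexp N k) :> {poly F}.
  rewrite -addnS big_split_ord /= big_ord_recl big_split /= addrCA addrC.
  rewrite [in RHS](reindex_inj rev_ord_inj) /= addrC.
  rewrite [X in _ = _ + X]addrC; congr (_ + (_ + _)).
  - by rewrite /jexp addn0 leqnn subnn !muln0.
  - by apply: eq_bigr => t _; rewrite /jexp /bump /= add1n leq_addr addKn.
  apply: eq_bigr => t _; have lt_tN := ltn_ord t.
  rewrite /jexp leqNgt [X in ~~ X](_ : _ = true); last lia.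
  by have -> : (N - (N - t.+1) = t.+1)%N by lia.
rewrite finite_triple_product mulr_sumr; apply: eqmodX_sum => k.
have le_k : (k <= N + N)%N by rewrite -ltnS.
rewrite mulrA -[X in eqmodX _ _ X]mul1r.
apply: (eqmodX_leq (leq_jexp le_k)); apply: eqmodX_mulX.
have := @qbin_stable (minn k (N + N - k)) N (N + N - k) k.
by rewrite (subnKC le_k); apply; lia.
Qed.

End JacobiTriple.

(** * Squares and parity of exponents over F_2 *)

Local Notation F2X := {poly 'F_2}.

Lemma natr_F2 k : k%:R = (odd k)%:R :> 'F_2.
Proof.
by rewrite -[in LHS](odd_double_half k) natrD -mul2n natrM (_ : 2%:R = 0) ?mul0r ?addr0 //;
  apply/eqP.
Qed.

Lemma addpp_F2 (p : F2X) : p + p = 0.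
Proof.
apply/polyP => i; rewrite coefD coef0 -mulr2n -mulr_natr.
by rewrite natr_F2 mulr0.
Qed.

Lemma opp_F2 (p : F2X) : - p = p.
Proof. by apply/eqP; rewrite -subr_eq0 -opprD addpp_F2 oppr0. Qed.

Lemma sqrD_F2 (p u : F2X) : (p + u) ^+ 2 = p ^+ 2 + u ^+ 2.
Proof. by rewrite sqrrD mulr2n addpp_F2 addr0. Qed.

Lemma sqr_comp_F2 (p : F2X) : p ^+ 2 = p \Po 'X^2.
Proof.
elim/poly_ind: p => [|p c IHp]; first by rewrite comp_poly0 expr0n.
rewrite sqrD_F2 exprMn IHp comp_polyD comp_polyM comp_polyX comp_polyC.
by congr (_ + _); rewrite -polyC_exp; congr _%:P; case: c => [[|[|c]] ?] //; apply: val_inj.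
Qed.

Lemma coef_sqr_F2 (p : F2X) i : (p ^+ 2)`_i = if odd i then 0 else p`_(i./2).
Proof. by rewrite sqr_comp_F2 coef_comp_poly_Xn // dvdn2 divn2; case: odd. Qed.

Definition parity_poly (b : bool) (p : F2X) := forall i, odd i != b -> p`_i = 0.

Lemma parityM b1 b2 p1 p2 :
  parity_poly b1 p1 -> parity_poly b2 p2 -> parity_poly (b1 (+) b2) (p1 * p2).
Proof.
move=> h1 h2 i odd_i; rewrite coefM big1 // => j _.
case: (eqVneq (odd j) b1) => [ej|/h1 ->]; last by rewrite mul0r.
rewrite [X in _ * X]h2 ?mulr0 // oddB -1?ltnS // ej.
by move: odd_i; case: (odd i) b1 b2 {h1 h2 ej} => [] [] [].
Qed.

Lemma parity_sqr p : parity_poly false (p ^+ 2).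
Proof. by move=> i; rewrite coef_sqr_F2; case: odd. Qed.

Lemma qpoch_sqr_F2 (p : F2X) n : qpoch p n ^+ 2 = qpoch (p ^+ 2) n.
Proof.
rewrite /qpoch -prodrXl; apply: eq_bigr => i _.
by rewrite sqrD_F2 expr1n !opp_F2 exprAC.
Qed.

(** * The Euler product and its cube modulo 2 *)

Local Notation euler := (qpoch ('X : F2X)).

Lemma euler_stable r n : (r <= n)%N -> eqmodX r.+1 (euler n) (euler r).
Proof. by move=> le_rn; have := @qpoch_stable 'F_2 1 isT r n le_rn; rewrite expr1 mul1n. Qed.

(** Triple product with c = 3, a = 1: the three residue classes modulo 3 make up all factors, and
    signs vanish in F_2. With u = t + 1 the exponents are u(3u - 1)/2 and u(3u + 1)/2. *)
Lemma euler_pentagonal N : eqmodX N (euler N)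
  (1 + \sum_(t < N) ('X^(3 * 'C(t.+1, 2) + t.+1) + 'X^(3 * 'C(t.+2, 2) - t.+1))).
Proof.
have := @triple_product_mod 'F_2 3 1 isT isT N.
under [X in eqmodX _ _ (_ + X)]eq_bigr => t _ do rewrite !mul1n.
apply: eqmodX_trans.
suff -> : qpoch 'X^3 N * \prod_(j < N) ((1 + 'X^(3 * j + 1)) * (1 + 'X^(3 * j + (3 - 1)))) =
  euler (3 * N).
  apply: eqmodX_sym; apply: (@eqmodX_leq _ N.+1) => //.
  by apply: euler_stable; rewrite leq_pmull.
elim: N => [|N IHN]; first by rewrite big_ord0 mulr1 /qpoch !big_ord0.
rewrite big_ord_recr mulnS !addSn add0n !qpochS -IHN /= -exprM !opp_F2.
rewrite (_ : 3 - 1 = 2)%N // addn1 addn2 mulnS !addSn add0n.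
move: (qpoch _ _) (bigop _ _ _) => u v; ring.
Qed.

(** Triple product with c = 4, a = 1: with u = t + 1 the exponents are C(2u, 2) and C(2u + 1, 2). On
    the product side E(q^4) = E^4, and the odd factors give E / E(q^2) = 1 / E. *)
Lemma euler_cube N : eqmodX N (euler N ^+ 3) (\sum_(m < (N + N).+1) 'X^('C(m.+1, 2))).
Proof.
have -> : \sum_(m < (N + N).+1) 'X^('C(m.+1, 2)) =
    1 + \sum_(t < N) ('X^(4 * 'C(t.+1, 2) + 1 * t.+1) +
                      'X^(4 * 'C(t.+2, 2) - 1 * t.+1)) :> F2X.
  elim: N => [|N IHN]; first by rewrite big_ord0 big_ord1 addr0.
  rewrite addSn addnS 2!big_ord_recr /= IHN [X in _ = 1 + X]big_ord_recr /= !addrA.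
  congr (_ + 'X^_ + 'X^_).
    by have := bin2_double (N + N).+2; have := bin2_double N.+1; lia.
  by have := bin2_double (N + N).+3; have := bin2_double N.+2; lia.
apply: (@eqmodX_trans _ _ _ _ _ _ (@triple_product_mod 'F_2 4 1 isT isT N)).
set O := \prod_(j < N) _.
have O_euler : O * qpoch 'X^2 (2 * N) = euler (4 * N).
  rewrite /O; elim: {O} N => [|N IHN]; first by rewrite !muln0 /qpoch !big_ord0 mulr1.
  rewrite big_ord_recr !mulnS !addSn !add0n !qpochS -IHN /= -!exprM !opp_F2.
  rewrite (_ : 4 - 1 = 3)%N // !mulnS !mulnA !addnS !addn0 !addSn !add0n.
  move: (qpoch _ _) (bigop _ _ _) => u v; ring.
have E4 : qpoch 'X^4 N = euler N ^+ 2 * euler N ^+ 2.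
  by rewrite -expr2 !qpoch_sqr_F2 -exprM.
have stable k : (N <= k)%N -> eqmodX N (euler N) (euler k).
  move=> le_Nk; apply: eqmodX_sym.
  by apply: (@eqmodX_leq _ N.+1) => //; apply: euler_stable.
rewrite E4 -mulrA exprSr; apply: eqmodXMl; apply: eqmodX_sym.
apply: (@eqmodX_trans _ _ _ (euler (2 * N) ^+ 2 * O)).
  by apply: eqmodXM; [apply/eqmodXX/stable; rewrite leq_pmull | apply: eqmodX_refl].
rewrite qpoch_sqr_F2 mulrC O_euler; apply: eqmodX_sym; apply: stable.
by rewrite leq_pmull.
Qed.

(** * Partition series and extraction of the even coefficients *)

Definition partition_poly (M k : nat) : F2X :=
  \poly_(n < M) (nb_partitions k n)%:R.

(** By [nb_partitionsS], the factor 1 - X^(k+1) turns the series for bound k + 1 into the one for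
    bound k. *)
Lemma euler_partition_poly M k : eqmodX M (euler k * partition_poly M k) 1.
Proof.
elim: k => [|k IHk].
  rewrite /qpoch big_ord0 mul1r; apply/eqmodXP => i lt_iM.
  by rewrite coef_poly lt_iM nb_partitions0 coef1.
rewrite qpochS -mulrA; apply: eqmodX_trans IHk; apply: eqmodXMl.
apply/eqmodXP => i lt_iM.
rewrite opp_F2 mulrDl mul1r mulrC coefD coefMXn !coef_poly lt_iM.
rewrite (leq_ltn_trans (leq_subr _ _) lt_iM) nb_partitionsS natrD -addrA ltnS.
case: leqP => _; rewrite ?addr0 //.
by rewrite -natrD addnn [X in _ + X]natr_F2 odd_double addr0.
Qed.

Lemma sum_monomials_parity b n (Q : pred 'I_n) (f : 'I_n -> nat) :
  (forall i, Q i -> odd (f i) = b) -> parity_poly b (\sum_(i < n | Q i) 'X^(f i)).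
Proof.
move=> Qb i odd_i; rewrite coef_sum big1 // => j /Qb fj; rewrite coefXn.
by case: eqP => // def_i; rewrite -fj def_i eqxx in odd_i.
Qed.

Lemma coef_odd_part_mul M m (E P psi_o psi_e : F2X) :
  eqmodX M (E * P) 1 -> eqmodX M (E ^+ 3) (psi_o + psi_e) ->
  parity_poly true psi_o -> parity_poly false psi_e ->
  (m.*2 < M)%N -> E`_m = 0 -> (psi_o * P)`_(m.*2) = 0.
Proof.
move=> EP1 E3 odd_o even_e lt_mM Em0.
have lt_m : (m < M)%N by lia.
have P4E : eqmodX M P ((psi_o + psi_e) * (P ^+ 2) ^+ 2).
  apply: (@eqmodX_trans _ _ _ (E ^+ 3 * (P ^+ 2) ^+ 2)); last first.
    by apply: eqmodXM => //; apply: eqmodX_refl.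
  have -> : E ^+ 3 * (P ^+ 2) ^+ 2 = P * (E * P) ^+ 3 by ring.
  rewrite -[X in eqmodX _ X _]mulr1; apply/eqmodXMl/eqmodX_sym.
  by rewrite -[X in eqmodX _ _ X](expr1n _ 3); apply: eqmodXX.
have P2E : eqmodX M ((psi_o + psi_e) * P ^+ 2) E.
  apply: (@eqmodX_trans _ _ _ (E ^+ 3 * P ^+ 2)).
    by apply: eqmodXM (eqmodX_sym E3) (eqmodX_refl _ _).
  have -> : E ^+ 3 * P ^+ 2 = E * (E * P) ^+ 2 by ring.
  rewrite -[X in eqmodX _ _ X]mulr1; apply/eqmodXMl.
  by rewrite -[X in eqmodX _ _ X](expr1n _ 2); apply: eqmodXX.
have /eqmodXP/(_ _ lt_mM) -> := eqmodXMl psi_o P4E.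
(* The first term is a square; the second has only odd exponents, so it does not reach [m.*2]. *)
have -> : psi_o * ((psi_o + psi_e) * (P ^+ 2) ^+ 2) =
    (psi_o * P ^+ 2) ^+ 2 + psi_o * psi_e * (P ^+ 2) ^+ 2 by ring.
rewrite coefD [X in _ + X](parityM (parityM odd_o even_e) (parity_sqr _)) ?odd_double //.
rewrite addr0 coef_sqr_F2 odd_double doubleK.
have odd_oP : parity_poly true (psi_o * P ^+ 2) := parityM odd_o (parity_sqr P).
(* For odd [m] the even part [psi_e * P ^+ 2] contributes nothing at [m], so the coefficient is that
   of [E]. *)
case odd_m : (odd m); last by rewrite odd_oP // odd_m.
have /eqmodXP/(_ _ lt_m) := P2E; rewrite Em0 mulrDl coefD.
by rewrite [X in _ + X](parityM even_e (parity_sqr P)) ?addr0 // odd_m.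
Qed.

(** * Pentagonal numbers modulo 5, and the parity of the mex count *)

Lemma pentagonal_residue5 m t :
  (m + m + t = 3 * (t * t))%N \/ (m + m = 3 * (t * t) + t)%N ->
  ~~ ((m %% 5 == 3) || (m %% 5 == 4))%N.
Proof.
have [x [y [lt_y5 ->]]] : exists x y, (y < 5)%N /\ t = (x * 5 + y)%N.
  by exists (t %/ 5)%N, (t %% 5)%N; rewrite ltn_mod -divn_eq.
have -> : ((x * 5 + y) * (x * 5 + y) = 5 * (5 * (x * x) + 2 * (x * y)) + y * y)%N.
  by lia.
move: (x * x)%N => w; case: y lt_y5 => [|[|[|[|[|//]]]]] _; lia.
Qed.

Lemma euler_mod5 N m : (m < N)%N -> ((m %% 5 == 3) || (m %% 5 == 4))%N ->
  (euler N)`_m = 0.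
Proof.
move=> lt_mN m5; have /eqmodXP/(_ _ lt_mN) -> := euler_pentagonal N.
rewrite coefD coef1 coef_sum big1 => [|t _].
  by rewrite addr0; case: m m5 {lt_mN}.
rewrite coefD !coefXn.
have e1 := bin2_double t.+1; have e2 := bin2_double t.+2.
have neq1 : m != (3 * 'C(t.+1, 2) + t.+1)%N.
  by apply: contraL m5 => /eqP ->; apply: (@pentagonal_residue5 _ t.+1); lia.
have neq2 : m != (3 * 'C(t.+2, 2) - t.+1)%N.
  by apply: contraL m5 => /eqP ->; apply: (@pentagonal_residue5 _ t.+1); lia.
by rewrite (negbTE neq1) (negbTE neq2) addr0.
Qed.

Lemma odd_bin2S m : odd 'C(m.+1, 2) = ((m %% 4 == 1) || (m %% 4 == 2))%N.
Proof.
elim/ltn_ind: m => -[|[|[|[|m]]]] // IHm.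
have -> : 'C(m.+4.+1, 2) = ('C(m.+1, 2) + (m * 2 + 5).*2)%N.
  by rewrite !binS !bin1 !bin0; lia.
by rewrite oddD odd_double addbF IHm; lia.
Qed.

(** The indices counted are 1 and 2 modulo 4, so the running count modulo 2 is 0, 0, 1, 0 with
    period 4. This is how the odd triangular exponents detect a mex that is 2 modulo 4. *)
Lemma odd_count_lt_mod4 K x :
  odd (\sum_(m < K | odd 'C(m.+1, 2)) (m < x)) = (minn x K %% 4 == 2)%N.
Proof.
elim: K => [|K IHK]; first by rewrite big_ord0 minn0.
rewrite big_mkcond big_ord_recr -big_mkcond /= oddD IHK odd_bin2S.
by case: (ltnP K x) => ?; case: orP; lia.
Qed.

(** Double counting: by [count_mex_gt] the coefficient counts pairs of a partition and an [m] below
    its mex with ['C(m.+1, 2)] odd; then sum over the partitions first. *)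
Lemma count_mex_mod4 n N : (n < N)%N ->
  (count (fun s => mex s %% 4 == 2)%N (partitions n))%:R =
  ((\sum_(m < (N + N).+1 | odd 'C(m.+1, 2)) 'X^('C(m.+1, 2))) *
     partition_poly n.+1 n)`_n :> 'F_2.
Proof.
move=> lt_nN; rewrite mulr_suml coef_sum.
under eq_bigr => m _.
  rewrite mulrC coefMXn coef_poly ltnS leq_subr nb_partitions_all ?leq_subr //.
  have -> : (if (n < 'C(m.+1, 2))%N then 0
      else (size (partitions (n - 'C(m.+1, 2))))%:R) =
      (count (fun s => m < mex s)%N (partitions n))%:R :> 'F_2.
    by rewrite count_mex_gt; case: ltnP.
  over.
rewrite -natr_sum; under eq_bigr => m _ do rewrite -sum1_count big_mkcond.
rewrite exchange_big /= -sum1_count big_mkcond /= !natr_sum.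
rewrite big_seq [RHS]big_seq; apply: eq_bigr => s s_part.
(* The truncation of psi thus cuts off no [m] below the mex. *)
have le_mex : (mex s <= (N + N).+1)%N.
  rewrite leqNgt; apply/negP => lt_mex.
  have : (N + N).+1 \in s.
    by have := lt_mex; rewrite mex_gtE => /allP; apply; rewrite mem_iota; lia.
  by move/(part_le s_part); lia.
rewrite [RHS]natr_F2.
rewrite (eq_bigr (fun m : 'I__ => nat_of_bool (m < mex s)%N)) => [|m _]; last by case: ltnP.
by rewrite odd_count_lt_mod4 (minn_idPl le_mex); case: eqP.
Qed.

Lemma sigma_e_mex_mod4 n :
  sigma_e_mex n =
  (2 * count (fun s => mex s %% 4 == 2)%N (partitions n))%N %[mod 4].
Proof.
rewrite /sigma_e_mex -sum1_count big_distrr /= big_mkcond [in RHS]big_mkcond.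
elim/big_ind2: _ => // [x1 x2 y1 y2 e1 e2|s _].
  by rewrite -modnDm e1 e2 modnDm.
by case: ifP; case: ifP; lia.
Qed.

Lemma sigma_e_mex_double m : ((m %% 5 == 3) || (m %% 5 == 4))%N ->
  sigma_e_mex m.*2 = 0 %[mod 4].
Proof.
move=> m5; set n := m.*2; rewrite sigma_e_mex_mod4.
suff : ~~ odd (count (fun s => mex s %% 4 == 2)%N (partitions n)) by lia.
pose N := n.+1; set k := count _ _.
have Pn_stable : eqmodX n.+1 (euler N * partition_poly n.+1 n) 1.
  apply: eqmodX_trans (euler_partition_poly n.+1 n).
  by apply: eqmodXM (eqmodX_refl _ _); apply: euler_stable.
have k0 : k%:R = 0 :> 'F_2.
  rewrite (@count_mex_mod4 n N) //.
  (* This splits psi into its odd part psi_o and its even part. *)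
  have := euler_cube N; rewrite (bigID (fun m : 'I__ => odd 'C(m.+1, 2))) => cube.
  apply: (coef_odd_part_mul Pn_stable cube _ _ _ (@euler_mod5 N m _ m5)) => //.
  - exact: sum_monomials_parity.
  - by apply: sum_monomials_parity => i /negbTE.
  - by rewrite /N /n; lia.
by move: k0; rewrite natr_F2; case: (odd k) => // /eqP.
Qed.

Local Close Scope ring_scope.

Theorem theorem1p1 (n : nat) :
  sigma_e_mex (10 * n + 6) = 0 %[mod 4] /\ sigma_e_mex (10 * n + 8) = 0 %[mod 4].
Proof.
split.
  have -> : 10 * n + 6 = (5 * n + 3).*2 by lia.
  by apply: sigma_e_mex_double; lia.
have -> : 10 * n + 8 = (5 * n + 4).*2 by lia.
by apply: sigma_e_mex_double; lia.
Qed.
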